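(* Let $p$ be a prime. For all integers $n\ge 0$, $$ \mathcal{E}_{pn}^{(p)}\equiv(-1)^n\pmod{p^2}. $$
   Context: For an integer $d\ge 2$, the generalized Euler numbers $\mathcal{E}_n^{(d)}$, $n\ge 0$, are defined by the formal power series identity $$ \sum_{n\ge 0}\mathcal{E}_n^{(d)}\frac{x^n}{n!}=\frac{1}{1+x^d/d!+x^{2d}/(2d)!+\cdots}=\frac{1}{\sum_{k\ge 0}x^{dk}/(dk)!}, $$ i.e. $\mathcal{E}_n^{(d)}$ is $n!$ times the coefficient of $x^n$ in the multiplicative inverse of the formal power series $\sum_{k\ge0}x^{dk}/(dk)!$ over $\mathbb{Q}$. These numbers are integers. *)

(* Defs.v *)
From mathcomp Require Import all_boot all_order all_algebra.

Set Implicit Arguments.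
Unset Strict Implicit.
Unset Printing Implicit Defensive.

Import Order.TTheory GRing.Theory Num.Theory.

Local Open Scope ring_scope.

(* MathComp has no formal power series: a series over a field F is represented
   by its coefficient sequence nat -> F. *)
Definition fps_one (F : fieldType) : nat -> F := fun n => (n == 0)%:R.

Definition fps_mul (F : fieldType) (f g : nat -> F) : nat -> F :=
  fun n => \sum_(i < n.+1) f i * g (n - i)%N.

(* Coefficients 0, ..., n of 1 / f, by solving f * g = 1 degree by degree. *)
Fixpoint fps_inv_seq (F : fieldType) (f : nat -> F) (n : nat) : seq F :=
  if n is m.+1 then
    let s := fps_inv_seq f m in
    rcons s (- (f 0)^-1 * \sum_(i < m.+1) f i.+1 * s`_(m - i))
  else [:: (f 0)^-1].

(* The multiplicative inverse of f, meaningful when f 0 != 0; fps_mulV and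
   fps_inv_uniq below characterise it. *)
Definition fps_inv (F : fieldType) (f : nat -> F) : nat -> F :=
  fun n => (fps_inv_seq f n)`_n.

Lemma size_fps_inv_seq (F : fieldType) (f : nat -> F) (n : nat) :
  size (fps_inv_seq f n) = n.+1.
Proof. by elim: n => //= n IHn; rewrite size_rcons IHn. Qed.

Lemma nth_fps_inv_seq (F : fieldType) (f : nat -> F) (m n : nat) :
  (m <= n)%N -> (fps_inv_seq f n)`_m = fps_inv f m.
Proof.
elim: n => [|n IHn]; first by rewrite leqn0 => /eqP->.
rewrite leq_eqVlt => /predU1P[-> //|ltmn].
by rewrite /= nth_rcons size_fps_inv_seq ltmn IHn.
Qed.

Lemma fps_invS (F : fieldType) (f : nat -> F) (n : nat) :
  fps_inv f n.+1 =
    - (f 0)^-1 * \sum_(i < n.+1) f i.+1 * fps_inv f (n - i)%N.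
Proof.
rewrite {1}/fps_inv /= nth_rcons size_fps_inv_seq ltnn eqxx.
by congr (_ * _); apply: eq_bigr => i _; rewrite nth_fps_inv_seq ?leq_subr.
Qed.

Lemma fps_mulV (F : fieldType) (f : nat -> F) :
  f 0 != 0 -> fps_mul f (fps_inv f) =1 fps_one F.
Proof.
move=> f0 [|n]; rewrite /fps_mul /fps_one big_ord_recl subn0.
  by rewrite big_ord0 addr0 /fps_inv /= mulfV.
by rewrite fps_invS mulrA mulrN mulfV // mulN1r addrC subrr.
Qed.

Lemma fps_inv_uniq (F : fieldType) (f g : nat -> F) :
  f 0 != 0 -> fps_mul f g =1 fps_one F -> g =1 fps_inv f.
Proof.
move=> f0 fg1 n; elim/ltn_ind: n => n IHn.
have := fg1 n; rewrite -(fps_mulV f0) /fps_mul !big_ord_recl !subn0.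
rewrite [X in _ + X = _](_ : _ = \sum_(i < n)
  f (lift ord0 i) * fps_inv f (n - lift ord0 i)%N).
  by move/addIr/(mulfI f0).
apply: eq_bigr => i _; rewrite IHn // lift0.
by rewrite ltn_subrL (leq_ltn_trans _ (ltn_ord i)).
Qed.

(* The series \sum_(k >= 0) x^(d k) / (d k)!, for d > 0: its coefficient of x^m
   is 1 / m! when m is a multiple of d, and 0 otherwise. *)
Definition exp_section (d : nat) : nat -> rat :=
  fun m => if (d %| m)%N then (m`!%:R)^-1 else 0.

(* The generalized Euler number E_n^(d), as a rational number. *)
Definition gen_euler (d n : nat) : rat :=
  n`!%:R * fps_inv (exp_section d) n.

(* Main.v *)
Require Import Defs.
From mathcomp Require Import all_boot all_order all_algebra.

Import Order.TTheory GRing.Theory Num.Theory.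

Local Open Scope ring_scope.

(** Write a_n for the generalized Euler number of order d and index d n. Clearing
    factorials in the identity that defines the inverse series gives the
    recurrence
      \sum_(k <= n) 'C(d n, d k) a_(n - k) = (n == 0)    [gen_euler_rec],
    since only the indices divisible by d contribute. The sequence (-1)^n
    satisfies the analogous recurrence with 'C(n, k) in place of 'C(d n, d k),
    because (-1 + 1)^n = (n == 0). When d = p is prime,
      'C(p n, p k) = 'C(n, k) modulo p ^ 2               [bin_mul_prime_sqr],
    so the two recurrences agree modulo p ^ 2; both have leading coefficient 1,
    hence so do their solutions.

    The last step is carried out on the differences a_n - (-1)^n: subtracting the
    recurrences expresses such a difference as a combination, with integer
    coefficients, of the earlier differences and of the numbers
    'C(p n, p k) - 'C(n, k). Showing by induction that it becomes an integer
    after division by p ^ 2 yields the integrality of a_n and the congruence at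
    once. *)

(** Since m 'C(p n, m) = p n 'C(p n - 1, m - 1), a prime p not dividing m has to
    divide the binomial coefficient. *)
Lemma prime_dvd_bin_mul (p n m : nat) :
  prime p -> ~~ (p %| m)%N -> (p %| 'C(p * n, m))%N.
Proof.
move=> pp; case: m => [|m pNm]; first by rewrite dvdn0.
have cpm : coprime p m.+1 by rewrite prime_coprime.
by rewrite -(Gauss_dvdr _ cpm) -mul_bin_diag -mulnA dvdn_mulr.
Qed.

(** Vandermonde's identity splits a choice of p k elements among p + p n
    according to the number j taken from the first p. The extreme terms j = 0
    and j = p reproduce Pascal's rule; in the others, p divides both factors. *)
Lemma bin_mul_prime_sqr (p n k : nat) :
  prime p -> 'C(p * n, p * k) = 'C(n, k) %[mod p ^ 2].
Proof.
move=> pp; have p0 := prime_gt0 pp.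
elim: n k => [|n IHn] [|k]; rewrite ?muln0 ?bin0 //.
  by rewrite !bin_small // muln_gt0 p0.
have lepk : (p <= p * k.+1)%N by rewrite leq_pmulr.
rewrite mulnS -(binomial.Vandermonde p (p * n)) binS.
(* The sum over j runs to p (k + 1), but the terms with j > p vanish. *)
rewrite -(big_mkord xpredT (fun j => 'C(p, j) * 'C(p * n, p * k.+1 - j)))%N.
rewrite (big_cat_nat (n := p.+1)) //= [X in (_ + X)%N]big_nat.
rewrite [X in (_ + X)%N]big1; last first.
  by move=> j /andP[ltpj _]; rewrite bin_small.
rewrite addn0 big_nat_recr // big_ltn //= bin0 mul1n subn0 binn mul1n.
have -> : (p * k.+1 - p = p * k)%N by rewrite mulnS addKn.
set S := (\sum_(_ <= _ < _) _)%N.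
have /dvdnP[q ->] : (p ^ 2 %| S)%N.
  rewrite /S big_nat; apply: dvdn_sum => j /andP[j0 ltjp].
  rewrite expnS expn1 dvdn_mul //; first by rewrite prime_dvd_bin // j0.
  apply: prime_dvd_bin_mul => //.
  rewrite dvdn_subr ?dvdn_mulr //; last exact: leq_trans (ltnW ltjp) lepk.
  by rewrite gtnNdvd.
by rewrite addnAC addnC modnMDl -modnDm !IHn modnDm.
Qed.

Lemma sum_multiples (V : nmodType) (d n : nat) (F : nat -> V) :
    (0 < d)%N -> (forall i, ~~ (d %| i)%N -> F i = 0) ->
  \sum_(i < (d * n).+1) F i = \sum_(k < n.+1) F (d * k)%N.
Proof.
move=> d0 F0; elim: n => [|n IHn]; first by rewrite muln0 !big_ord1 muln0.
rewrite [RHS]big_ord_recr /= -IHn -!(big_mkord xpredT F).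
rewrite big_nat_recr //= (big_cat_nat (n := (d * n).+1)) //=; last first.
  by rewrite mulnS -[X in (X < _)%N]add0n ltn_add2r.
congr (_ + _); rewrite [X in _ + X]big_nat [X in _ + X]big1 ?addr0 //.
move=> i /andP[lt_dn_i]; rewrite ltnNge => /negP i_lt; apply: F0.
apply/negP => /dvdnP[q def_i]; apply: i_lt; move: lt_dn_i.
by rewrite def_i (mulnC q) ltn_pmul2l // leq_pmul2l.
Qed.

(** The defining identity of the inverse series, multiplied by (d n)!. *)
Lemma gen_euler_rec (d n : nat) : (0 < d)%N ->
  \sum_(k < n.+1) 'C(d * n, d * k)%:R * gen_euler d (d * (n - k))
    = (n == 0)%:R.
Proof.
move=> d0; have f0 : exp_section d 0 != 0.
  by rewrite /exp_section dvdn0 invr1 oner_eq0.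
have := fps_mulV f0 (d * n)%N; rewrite /fps_mul /fps_one.
rewrite (sum_multiples _ _ _ (fun i =>
  exp_section d i * fps_inv (exp_section d) (d * n - i)%N)) //; last first.
  by move=> i /negbTE dNi; rewrite /exp_section dNi mul0r.
move/(congr1 ( *%R (d * n)`!%:R)); rewrite mulr_sumr muln_eq0 eqn0Ngt d0 /=.
have -> : (d * n)`!%:R * (n == 0)%:R = (n == 0)%:R :> rat.
  by case: n => [|n] /=; rewrite ?muln0 ?mulr1 ?mulr0.
move<-; apply: eq_bigr => k _.
rewrite /exp_section dvdn_mulr // /gen_euler mulnBr !mulrA.
have lek : (d * k <= d * n)%N by rewrite leq_mul2l -ltnS ltn_ord orbT.
have k0 : (d * k)`!%:R != 0 :> rat by rewrite pnatr_eq0 -lt0n fact_gt0.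
by rewrite -(bin_fact lek) !natrM mulrCA [X in X / _]mulrC mulfK.
Qed.

Lemma sum_bin_sign (n : nat) :
  \sum_(k < n.+1) 'C(n, k)%:R * (-1) ^+ (n - k) = (n == 0)%:R :> rat.
Proof.
rewrite -expr0n -[X in X ^+ n](addNr 1) exprDn.
by apply: eq_bigr => k _; rewrite expr1n mulr1 mulr_natl.
Qed.

(** Subtracting [sum_bin_sign] from [gen_euler_rec] writes the difference for n
    in terms of the earlier differences and of 'C(p n, p k) - 'C(n, k), all of
    which are integral after division by p ^ 2: the former by induction, the
    latter by [bin_mul_prime_sqr]. *)
Lemma gen_euler_sign (p n : nat) : prime p ->
  (gen_euler p (p * n) - (-1) ^+ n) / (p ^ 2)%:R \is a Num.int.
Proof.
move=> pp; have p0 := prime_gt0 pp.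
pose D m := (gen_euler p (p * m) - (-1) ^+ m) / (p ^ 2)%:R.
pose B n k : rat := ('C(p * n, p * k)%:R - 'C(n, k)%:R) / (p ^ 2)%:R.
have B_int m k : B m k \is a Num.int.
  rewrite /B !pmulrn -intrB.
  by apply: Qint_dvdz; rewrite -eqz_mod_dvd !modz_nat bin_mul_prime_sqr.
rewrite -/(D n); elim/ltn_ind: n => n IHn.
have : \sum_(k < n.+1) ('C(p * n, p * k)%:R * D (n - k)%N
                        + B n k * (-1) ^+ (n - k)) = 0.
  rewrite -[RHS](mul0r (p ^ 2)%:R^-1) -[X in X / _](subrr ((n == 0)%:R)).
  rewrite -{1}(gen_euler_rec p n p0) -(sum_bin_sign n) -sumrB mulr_suml.
  apply: eq_bigr => k _; rewrite /D /B mulrA [X in _ + X]mulrAC -mulrDl.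
  by congr (_ / _); rewrite mulrBr mulrBl addrA subrK.
rewrite big_ord_recl muln0 bin0 mul1r subn0 -addrA => /eqP.
rewrite addr_eq0 => /eqP ->; rewrite rpredN rpredD //.
  by apply: rpredM => //; rewrite rpredX // rpredN.
apply: rpred_sum => k _; apply: rpredD.
  apply: rpredM; first exact: rpred_nat.
  apply: IHn; rewrite lift0 ltn_subrL /=.
  exact: leq_ltn_trans (ltn_ord k).
by apply: rpredM => //; rewrite rpredX // rpredN.
Qed.

Theorem theorem4p3 (p : nat) (p_prime : prime p) (n : nat) :
  exists e : int,
    gen_euler p (p * n) = e%:~R /\ (e = (-1) ^+ n %[mod (p ^ 2)%N])%Z.
Proof.
have P0 : (p ^ 2)%:R != 0 :> rat.
  by rewrite pnatr_eq0 expn_eq0 eqn0Ngt prime_gt0.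
have /intrP[z def_z] := gen_euler_sign p n p_prime.
exists (z * (p ^ 2)%N + (-1) ^+ n); split; last by rewrite modzMDl.
rewrite rmorphD rmorphM rmorphXn rmorphN1 /= -def_z.
by rewrite -[(_%:Z)%:~R]/((p ^ 2)%:R) divfK // subrK.
Qed.
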